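(* A truss $T$ is Boolean if and only if it is isomorphic (as a truss) to a direct product of trusses $$T_1\times T_2\times T_3\times T_4,$$ where (1) $T_1=\mathrm{T}(A,\circ)$ is the circle truss of a Boolean ring $A$; (2) $T_2=\mathrm{T}(B)$ for a Boolean ring $B$; (3) $T_3$ is a left zero truss; (4) $T_4$ is a right zero truss.
   Context: An Abelian heap is a set $H$ with a ternary operation $[-,-,-]$ such that for all $a_1,\dots,a_5\in H$: $[[a_1,a_2,a_3],a_4,a_5]=[a_1,a_2,[a_3,a_4,a_5]]$; $[a_1,a_2,a_2]=a_1$ and $[a_2,a_1,a_1]=a_2$; $[a_1,a_2,a_3]=[a_3,a_2,a_1]$. A truss is an Abelian heap $(T,[-,-,-])$ with an associative binary operation $\cdot$ satisfying $a\cdot[b,c,d]=[a\cdot b,a\cdot c,a\cdot d]$ and $[b,c,d]\cdot a=[b\cdot a,c\cdot a,d\cdot a]$ for all $a,b,c,d\in T$. A truss homomorphism is a map preserving both the ternary operation and the multiplication; an isomorphism is a bijective homomorphism. Direct products carry componentwise operations. A truss $T$ is Boolean if $a^2=a$ for all $a\in T$. Rings are associative and need not be unital; a Boolean ring is a (not necessarily unital) ring in which $x^2=x$ for all $x$. For a ring $R$, $\mathrm{T}(R)$ is the set $R$ with heap operation $[a,b,c]=a-b+c$ and the ring multiplication; the circle truss $\mathrm{T}(R,\circ)$ is the set $R$ with the same heap operation and multiplication $a\circ b=a+b+ab$. A left zero truss is an Abelian heap with multiplication $a\cdot b=a$ for all $a,b$; a right zero truss is an Abelian heap with multiplication $a\cdot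 b=b$ for all $a,b$. *)

(* Defs.v *)
From mathcomp Require Import all_boot all_algebra.

Set Implicit Arguments.
Unset Strict Implicit.
Unset Printing Implicit Defensive.

Import GRing.Theory.
Local Open Scope ring_scope.

(* Heaps may be empty: no axiom provides an element. *)
Record abHeap := AbHeap {
  heap_sort :> Type;
  hop : heap_sort -> heap_sort -> heap_sort -> heap_sort;
  hopA : forall a1 a2 a3 a4 a5 : heap_sort,
    hop (hop a1 a2 a3) a4 a5 = hop a1 a2 (hop a3 a4 a5);
  hopKr : forall a1 a2 : heap_sort, hop a1 a2 a2 = a1;
  hopKl : forall a1 a2 : heap_sort, hop a2 a1 a1 = a2;
  hopC : forall a1 a2 a3 : heap_sort, hop a1 a2 a3 = hop a3 a2 a1
}.

Record truss := Truss {
  truss_heap :> abHeap;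
  tmul : truss_heap -> truss_heap -> truss_heap;
  tmulA : forall a b c : truss_heap, tmul a (tmul b c) = tmul (tmul a b) c;
  tmulDr : forall a b c d : truss_heap,
    tmul a (hop b c d) = hop (tmul a b) (tmul a c) (tmul a d);
  tmulDl : forall a b c d : truss_heap,
    tmul (hop b c d) a = hop (tmul b a) (tmul c a) (tmul d a)
}.

Definition boolean_truss (T : truss) : Prop := forall a : T, tmul a a = a.

Definition truss_hom (S T : truss) (f : S -> T) : Prop :=
  (forall a b c : S, f (hop a b c) = hop (f a) (f b) (f c)) /\
  (forall a b : S, f (tmul a b) = tmul (f a) (f b)).

Definition truss_iso (S T : truss) : Prop :=
  exists f : S -> T, truss_hom f /\ bijective f.

Section Product.

Variables S T : truss.

Definition prod_hop (x y z : S * T) : S * T :=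
  (hop x.1 y.1 z.1, hop x.2 y.2 z.2).

Definition prod_mul (x y : S * T) : S * T := (tmul x.1 y.1, tmul x.2 y.2).

Lemma prod_hopA (a1 a2 a3 a4 a5 : S * T) :
  prod_hop (prod_hop a1 a2 a3) a4 a5 = prod_hop a1 a2 (prod_hop a3 a4 a5).
Proof. by rewrite /prod_hop /= !hopA. Qed.

Lemma prod_hopKr (a1 a2 : S * T) : prod_hop a1 a2 a2 = a1.
Proof. by case: a1 => x y; rewrite /prod_hop /= !hopKr. Qed.

Lemma prod_hopKl (a1 a2 : S * T) : prod_hop a2 a1 a1 = a2.
Proof. exact: prod_hopKr. Qed.

Lemma prod_hopC (a1 a2 a3 : S * T) : prod_hop a1 a2 a3 = prod_hop a3 a2 a1.
Proof. by rewrite /prod_hop hopC [X in (_, X)]hopC. Qed.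

Definition prod_heap : abHeap :=
  AbHeap prod_hopA prod_hopKr prod_hopKl prod_hopC.

Lemma prod_mulA (a b c : prod_heap) :
  prod_mul a (prod_mul b c) = prod_mul (prod_mul a b) c.
Proof. by rewrite /prod_mul /= !tmulA. Qed.

Lemma prod_mulDr (a b c d : prod_heap) :
  prod_mul a (hop b c d) =
  hop (prod_mul a b : prod_heap) (prod_mul a c) (prod_mul a d).
Proof. by rewrite /prod_mul /= !tmulDr. Qed.

Lemma prod_mulDl (a b c d : prod_heap) :
  prod_mul (hop b c d) a =
  hop (prod_mul b a : prod_heap) (prod_mul c a) (prod_mul d a).
Proof. by rewrite /prod_mul /= !tmulDl. Qed.

Definition prod_truss : truss :=
  @Truss prod_heap prod_mul prod_mulA prod_mulDr prod_mulDl.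

End Product.

(* Not necessarily unital rings, which MathComp does not provide.  The choice
   operator carried by zmodType is no restriction under the classical axioms. *)
Record rng := Rng {
  rng_sort :> zmodType;
  rmul : rng_sort -> rng_sort -> rng_sort;
  rmulA : associative rmul;
  rmulDl : left_distributive rmul +%R;
  rmulDr : right_distributive rmul +%R
}.

Definition boolean_rng (R : rng) : Prop := forall x : R, rmul x x = x.

Section RngTrusses.

Variable R : rng.

Definition rng_hop (a b c : R) : R := a - b + c.

Definition circ (a b : R) : R := a + b + rmul a b.

Lemma rng_hopA (a1 a2 a3 a4 a5 : R) :
  rng_hop (rng_hop a1 a2 a3) a4 a5 = rng_hop a1 a2 (rng_hop a3 a4 a5).
Proof. by rewrite /rng_hop !addrA. Qed.

Lemma rng_hopKr (a1 a2 : R) : rng_hop a1 a2 a2 = a1.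
Proof. exact: subrK. Qed.

Lemma rng_hopKl (a1 a2 : R) : rng_hop a2 a1 a1 = a2.
Proof. exact: subrK. Qed.

Lemma rng_hopC (a1 a2 a3 : R) : rng_hop a1 a2 a3 = rng_hop a3 a2 a1.
Proof. by rewrite /rng_hop addrC addrCA addrC. Qed.

Definition rng_heap : abHeap :=
  AbHeap rng_hopA rng_hopKr rng_hopKl rng_hopC.

Lemma rmulBr (a b c : R) : rmul a (b - c) = rmul a b - rmul a c.
Proof. by apply/(addIr (rmul a c)); rewrite -rmulDr !subrK. Qed.

Lemma rmulBl (a b c : R) : rmul (b - c) a = rmul b a - rmul c a.
Proof. by apply/(addIr (rmul c a)); rewrite -rmulDl !subrK. Qed.

Lemma rng_mulDr (a b c d : rng_heap) :
  rmul a (hop b c d) = hop (rmul a b : rng_heap) (rmul a c) (rmul a d).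
Proof. by rewrite /= /rng_hop rmulDr rmulBr. Qed.

Lemma rng_mulDl (a b c d : rng_heap) :
  rmul (hop b c d) a = hop (rmul b a : rng_heap) (rmul c a) (rmul d a).
Proof. by rewrite /= /rng_hop rmulDl rmulBl. Qed.

Definition rng_truss : truss :=
  @Truss rng_heap (@rmul R) (@rmulA R) rng_mulDr rng_mulDl.

Lemma circA (a b c : rng_heap) : circ a (circ b c) = circ (circ a b) c.
Proof.
rewrite /circ !(rmulDr, rmulDl) rmulA !addrA; congr (_ + _).
rewrite -!addrA; do 2!congr (_ + _); rewrite [RHS]addrCA; congr (_ + _).
by rewrite addrC addrA.
Qed.

Lemma rng_hopD (a b c x y z : R) :
  rng_hop (a + x) (b + y) (c + z) = rng_hop a b c + rng_hop x y z.
Proof. by rewrite /rng_hop opprD [a + x + _]addrACA [LHS]addrACA. Qed.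

Lemma circDr (a b c d : rng_heap) :
  circ a (hop b c d) = hop (circ a b : rng_heap) (circ a c) (circ a d).
Proof.
by rewrite /= /circ !rng_hopD rng_hopKr [rmul a _]rng_mulDr.
Qed.

Lemma circDl (a b c d : rng_heap) :
  circ (hop b c d) a = hop (circ b a : rng_heap) (circ c a) (circ d a).
Proof.
by rewrite /= /circ !rng_hopD rng_hopKr [rmul _ a]rng_mulDl.
Qed.

Definition circle_truss : truss := @Truss rng_heap circ circA circDr circDl.

End RngTrusses.

Section ZeroTrusses.

Variable H : abHeap.

Definition lzero_mul (a b : H) : H := a.
Definition rzero_mul (a b : H) : H := b.

Lemma lzero_mulDr (a b c d : H) :
  lzero_mul a (hop b c d) = hop (lzero_mul a b) (lzero_mul a c) (lzero_mul a d).
Proof. by rewrite hopKr. Qed.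

Definition left_zero_truss : truss :=
  @Truss H lzero_mul (fun _ _ _ => erefl) lzero_mulDr (fun _ _ _ _ => erefl).

Lemma rzero_mulDl (a b c d : H) :
  rzero_mul (hop b c d) a = hop (rzero_mul b a) (rzero_mul c a) (rzero_mul d a).
Proof. by rewrite hopKr. Qed.

Definition right_zero_truss : truss :=
  @Truss H rzero_mul (fun _ _ _ => erefl) (fun _ _ _ _ => erefl) rzero_mulDl.

End ZeroTrusses.

(* Main.v *)
Require Import Defs.
From HB Require Import structures.
From mathcomp Require Import all_boot all_algebra boolp.

Set Implicit Arguments.
Unset Strict Implicit.
Unset Printing Implicit Defensive.

Import GRing.Theory.
Local Open Scope ring_scope.

(** Fix a point [o] of a Boolean truss.  The heap becomes an abelian group with
    zero [o], and since multiplication respects the heap operation in each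
    argument and [o] is idempotent, it is an affine map without constant term:
<<
      m a b = a * b + lam a + rho b,   lam a = m a 0,   rho b = m 0 b,
>>
    with [*] biadditive and [lam], [rho] additive.

    Associativity with one argument equal to 0 makes [lam] and [rho] commuting
    idempotents satisfying
<<
      lam (a * b) = a * lam b,   rho (a * b) = rho a * b,
      lam a * b = a * rho b.
>>
    Idempotence reads [a * a + lam a + rho a = a]; as [lam] and [rho] are
    additive, polarizing it gives [b * a = - (a * b)].  Antisymmetry exchanges
    the sides on which [lam] and [rho] act in these identities, so that all of
<<
      lam (a * b), rho (a * b), lam a * b, a * lam b, rho a * b, a * rho b
>>
    are equal ([bilin_lpartl], [bilin_rpartr], [rpart_bilin]).  Then [*] is
    associative ([bilinA]) and the group is a ring.

    The four products of [lam] or [1 - lam] with [rho] or [1 - rho] are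
    orthogonal idempotent ring endomorphisms with sum 1, so the ring is the
    direct sum of their images, and [m] restricts to each image:
    - if [lam = rho = 1] it is [a * b + a + b], and [a * a = - a];
    - if [lam = rho = 0] it is [a * b], and [a * a = a];
    - if [lam] and [rho] differ, then [a * b = lam a * b = rho a * b] forces
      [a * b = 0], and [m] is the left or the right projection.
    In the first case polarization of [a * a = - a] gives [a + a = 0], so this
    summand is a Boolean ring as well.

    The empty truss has no point to start from and is decomposed separately.
    Conversely, all four kinds of factor are Boolean; for the circle truss this
    uses that a Boolean ring has characteristic 2. *)

Definition has_boolean_decomposition (T : truss) : Prop :=
  exists (A B : rng) (L R : abHeap),
    boolean_rng A /\ boolean_rng B /\
    truss_iso T
      (prod_truss
         (prod_truss
            (prod_truss (circle_truss A) (rng_truss B))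
            (left_zero_truss L))
         (right_zero_truss R)).

(** * The abelian group of a pointed heap *)

(** The group structure depends on the chosen zero, so [o] is kept as an
    argument of this alias of [H]: it is what instance inference reads. *)
Definition retract (H : abHeap) (o : H) : Type := H.

Section Retract.

Variables (H : abHeap) (o : H).

HB.instance Definition _ := gen_eqMixin (retract o).
HB.instance Definition _ := gen_choiceMixin (retract o).

Let add (a b : retract o) : retract o := hop a o b.
Let opp (a : retract o) : retract o := hop o a o.

Lemma hop_cancel_left (a b : H) : hop a a b = b.
Proof. by rewrite hopC hopKr. Qed.

Lemma retract_addA : associative add.
Proof. by move=> a b c; rewrite /add hopA. Qed.

Lemma retract_addC : commutative add.
Proof. by move=> a b; exact: hopC. Qed.

Lemma retract_add0 : left_id (o : retract o) add.
Proof. by move=> a; exact: hop_cancel_left. Qed.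

Lemma retract_addN : left_inverse (o : retract o) opp add.
Proof. by move=> a; rewrite /add /opp hopA hop_cancel_left hopKr. Qed.

HB.instance Definition _ := GRing.isZmodule.Build (retract o)
  retract_addA retract_addC retract_add0 retract_addN.

Lemma hop_retract (a b c : retract o) : hop a b c = a - b + c :> retract o.
Proof.
rewrite -[RHS]/(hop (hop a o (hop o b o) : H) o c).
by rewrite -hopA hopKr hopA hop_cancel_left.
Qed.

End Retract.

(** * The image of an idempotent ring endomorphism *)

(** The image of an idempotent map is its set of fixed points.  Being fixed is
    a Boolean equation, so the image is a subtype of [R] and inherits its
    additive group from it. *)
Section FixedRng.

Variables (R : rng) (p : {additive R -> R}).

Definition fixed : pred R := fun x => p x == x.

Lemma fixed_zmod_closed : zmod_closed fixed.
Proof.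
split=> [|x y /eqP px /eqP py]; first by rewrite unfold_in raddf0.
by rewrite unfold_in raddfB px py.
Qed.

HB.instance Definition _ := GRing.isZmodClosed.Build R fixed fixed_zmod_closed.

Definition fixed_sub : Type := {x : R | fixed x}.

HB.instance Definition _ := SubChoice.on fixed_sub.
HB.instance Definition _ := [SubChoice_isSubZmodule of fixed_sub by <:].

Lemma fixedE (u : fixed_sub) : p (val u) = val u.
Proof. exact: (eqP (valP u : fixed _)). Qed.

Hypothesis pM : forall x y, p (rmul x y) = rmul (p x) (p y).

Lemma fixed_mul_subproof (u v : fixed_sub) : fixed (rmul (val u) (val v)).
Proof. by apply/eqP; rewrite pM !fixedE. Qed.

Definition fixed_mul (u v : fixed_sub) : fixed_sub :=
  Sub (rmul (val u) (val v)) (fixed_mul_subproof u v).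

Lemma fixed_mulA : associative fixed_mul.
Proof. by move=> u v w; apply: val_inj; rewrite /= rmulA. Qed.

Lemma fixed_mulDl : left_distributive fixed_mul +%R.
Proof. by move=> u v w; apply: val_inj; rewrite /= rmulDl. Qed.

Lemma fixed_mulDr : right_distributive fixed_mul +%R.
Proof. by move=> u v w; apply: val_inj; rewrite /= rmulDr. Qed.

Definition fixed_rng : rng := Rng fixed_mulA fixed_mulDl fixed_mulDr.

Hypothesis pK : forall x, p (p x) = p x.

Lemma to_fixed_subproof x : fixed (p x).
Proof. by apply/eqP. Qed.

Definition to_fixed (x : R) : fixed_rng :=
  (Sub (p x) (to_fixed_subproof x) : fixed_sub).

Lemma to_fixedK (u : fixed_rng) : to_fixed (val u) = u.
Proof. by apply: val_inj; rewrite /= fixedE. Qed.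

Lemma eq_to_fixed x y : p x = p y -> to_fixed x = to_fixed y.
Proof. by move=> eq_p; apply: val_inj. Qed.

Lemma to_fixed0 x : p x = 0 -> to_fixed x = 0.
Proof. by move=> px0; apply: val_inj. Qed.

Lemma to_fixedD x y : to_fixed (x + y) = to_fixed x + to_fixed y.
Proof. by apply: val_inj; rewrite /= raddfD. Qed.

Lemma to_fixedB x y : to_fixed (x - y) = to_fixed x - to_fixed y.
Proof. by apply: val_inj; rewrite /= raddfB. Qed.

Lemma to_fixedM x y : to_fixed (rmul x y) = rmul (to_fixed x) (to_fixed y).
Proof. by apply: val_inj; rewrite /= pM. Qed.

End FixedRng.

(** * Splitting a ring along two commuting idempotents *)

(** The hypotheses say that a ring product twisted by [lam] and [rho] is
    idempotent and that every way of putting [lam] or [rho] into a product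
    gives the same element.  The projections [p11], [p00], [p10], [p01] are
    indexed by the values that [lam] and [rho] take on their images. *)
Section Peirce.

Variables (R : rng) (lam rho : {additive R -> R}).

Hypothesis lamK : forall x, lam (lam x) = lam x.
Hypothesis rhoK : forall x, rho (rho x) = rho x.
Hypothesis rho_lam : forall x, rho (lam x) = lam (rho x).
Hypothesis lamMl : forall x y, rmul (lam x) y = lam (rmul x y).
Hypothesis lamMr : forall x y, rmul x (lam y) = lam (rmul x y).
Hypothesis rhoMl : forall x y, rmul (rho x) y = lam (rmul x y).
Hypothesis rhoMr : forall x y, rmul x (rho y) = lam (rmul x y).
Hypothesis rhoM : forall x y, rho (rmul x y) = lam (rmul x y).
Hypothesis square : forall x, rmul x x + lam x + rho x = x.

Let p11 : {additive R -> R} := lam \o rho.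
Let p00 : {additive R -> R} := (idfun \- lam) \o (idfun \- rho).
Let p10 : {additive R -> R} := lam \o (idfun \- rho).
Let p01 : {additive R -> R} := (idfun \- lam) \o rho.

(* Oriented so that a product moves every projector outside, where it becomes
   [lam].  The additivity rules name [lam] and [rho] because the generic ones
   would also match the opposite, which is additive. *)
Let normalize := (raddfB lam, raddfB rho, rho_lam, lamK, rhoK,
  rmulBl, rmulBr, lamMl, lamMr, rhoMl, rhoMr, rhoM, raddf0 lam, raddf0 rho,
  oppr0, subrr, subr0, add0r, addr0).

Lemma p11M x y : p11 (rmul x y) = rmul (p11 x) (p11 y).
Proof. by rewrite /= !normalize. Qed.

Lemma p00M x y : p00 (rmul x y) = rmul (p00 x) (p00 y).
Proof. by rewrite /= !normalize. Qed.

Lemma p10M x y : p10 (rmul x y) = rmul (p10 x) (p10 y).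
Proof. by rewrite /= !normalize. Qed.

Lemma p01M x y : p01 (rmul x y) = rmul (p01 x) (p01 y).
Proof. by rewrite /= !normalize. Qed.

Lemma p11K x : p11 (p11 x) = p11 x. Proof. by rewrite /= !normalize. Qed.
Lemma p00K x : p00 (p00 x) = p00 x. Proof. by rewrite /= !normalize. Qed.
Lemma p10K x : p10 (p10 x) = p10 x. Proof. by rewrite /= !normalize. Qed.
Lemma p01K x : p01 (p01 x) = p01 x. Proof. by rewrite /= !normalize. Qed.

Lemma peirce_sum x : p11 x + p00 x + p10 x + p01 x = x.
Proof.
(* p00 + p10 = 1 - rho and p01 + p11 = rho. *)
rewrite [LHS](AC (1*1*1*1) ((2*3)*(4*1))) /=.
by rewrite !subrK.
Qed.

Lemma peirce_orthogonal x :
  [/\ [/\ p00 (p11 x) = 0, p10 (p11 x) = 0 & p01 (p11 x) = 0],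
      [/\ p11 (p00 x) = 0, p10 (p00 x) = 0 & p01 (p00 x) = 0],
      [/\ p11 (p10 x) = 0, p00 (p10 x) = 0 & p01 (p10 x) = 0]
    & [/\ p11 (p01 x) = 0, p00 (p01 x) = 0 & p10 (p01 x) = 0]].
Proof. by split; split; rewrite /= !normalize. Qed.

Let A := fixed_rng p11M.
Let B := fixed_rng p00M.
Let L : abHeap := rng_heap (fixed_rng p10M).
Let S : abHeap := rng_heap (fixed_rng p01M).
Let P := prod_truss (prod_truss (prod_truss (circle_truss A) (rng_truss B))
  (left_zero_truss L)) (right_zero_truss S).

Let toA : R -> A := to_fixed p11M p11K.
Let toB : R -> B := to_fixed p00M p00K.
Let toL : R -> fixed_rng p10M := to_fixed p10M p10K.
Let toR : R -> fixed_rng p01M := to_fixed p01M p01K.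

Lemma toA_mul x y : toA (rmul x y + lam x + rho y) = circ (toA x) (toA y).
Proof.
rewrite /circ [RHS]addrC addrA /toA !to_fixedD to_fixedM.
by congr (_ + _ + _); apply: eq_to_fixed; rewrite /= !normalize.
Qed.

Lemma toB_mul x y : toB (rmul x y + lam x + rho y) = rmul (toB x) (toB y).
Proof.
rewrite /toB !to_fixedD to_fixedM [_ (lam x)]to_fixed0 ?[_ (rho y)]to_fixed0.
- by rewrite !addr0.
- by rewrite /= !normalize.
- by rewrite /= !normalize.
Qed.

(** [p10] annihilates products, since [rho] acts on them as [lam] does: this is
    why no product survives in the two zero trusses. *)
Lemma toL_mul x y : toL (rmul x y + lam x + rho y) = toL x.
Proof. by apply: eq_to_fixed; rewrite !(raddfD p10) /= !normalize. Qed.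

Lemma toR_mul x y : toR (rmul x y + lam x + rho y) = toR y.
Proof. by apply: eq_to_fixed; rewrite !(raddfD p01) /= !normalize. Qed.

Definition peirce_map (x : R) : P := (((toA x, toB x), toL x), toR x).

Lemma peirce_map_bij : bijective peirce_map.
Proof.
exists (fun y : P => val y.1.1.1 + val y.1.1.2 + val y.1.2 + val y.2).
  exact: peirce_sum.
case=> [[[a b] c] d] /=; rewrite /peirce_map.
have [[A1 A2 A3] _ _ _] := peirce_orthogonal (val a).
have [_ [B1 B2 B3] _ _] := peirce_orthogonal (val b).
have [_ _ [C1 C2 C3] _] := peirce_orthogonal (val c).
have [_ _ _ [D1 D2 D3]] := peirce_orthogonal (val d).
rewrite (fixedE a) in A1 A2 A3; rewrite (fixedE b) in B1 B2 B3.
rewrite (fixedE c) in C1 C2 C3; rewrite (fixedE d) in D1 D2 D3.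
congr (_, _, _, _); rewrite /toA /toB /toL /toR !to_fixedD to_fixedK.
- by rewrite !to_fixed0 // !addr0.
- by rewrite !to_fixed0 // !addr0 add0r.
- by rewrite !to_fixed0 // !addr0 !add0r.
- by rewrite !to_fixed0 // !add0r.
Qed.

Lemma peirce_map_hop (x y z : R) :
  peirce_map (x - y + z) = hop (peirce_map x) (peirce_map y) (peirce_map z).
Proof.
by congr (_, _, _, _); rewrite /toA /toB /toL /toR to_fixedD to_fixedB.
Qed.

Lemma peirce_map_mul (x y : R) :
  peirce_map (rmul x y + lam x + rho y) = tmul (peirce_map x) (peirce_map y).
Proof. by rewrite /peirce_map toA_mul toB_mul toL_mul toR_mul. Qed.

(** Here the hypothesis [square] becomes [u * u = - u]; applied to [u + u] it
    gives [u + u = 0], hence [u * u = u]. *)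
Lemma boolean_p11 : boolean_rng A.
Proof.
have sqN (u : A) : rmul u u = - u.
  have := toA_mul (val u) (val u); rewrite square /toA to_fixedK /circ => eq_u.
  apply/(addIr u)/(addIr u).
  by rewrite addNr add0r [RHS]eq_u -[LHS]addrA addrC.
move=> u; rewrite sqN; apply/eqP; rewrite -subr_eq0; apply/eqP/(addIr (- u - u)).
by have := sqN (u + u); rewrite rmulDl rmulDr sqN opprD add0r.
Qed.

Lemma boolean_p00 : boolean_rng B.
Proof.
by move=> u; have := toB_mul (val u) (val u); rewrite square /toB to_fixedK.
Qed.

Lemma peirce_iso (T : truss) (f : T -> R) : bijective f ->
  (forall a b c, f (hop a b c) = f a - f b + f c) ->
  (forall a b, f (tmul a b) = rmul (f a) (f b) + lam (f a) + rho (f b)) ->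
  has_boolean_decomposition T.
Proof.
move=> f_bij f_hop f_mul; exists A, B, L, S.
split; first exact: boolean_p11.
split; first exact: boolean_p00.
exists (peirce_map \o f); split; last exact: bij_comp peirce_map_bij f_bij.
split=> [a b c | a b]; rewrite [LHS]/=.
  by rewrite f_hop peirce_map_hop.
by rewrite f_mul peirce_map_mul.
Qed.

End Peirce.

(** * The ring of a pointed Boolean truss *)

Section BooleanTruss.

Variables (T : truss) (o : T).
Hypothesis T_boolean : boolean_truss T.

Let G := retract o.
Let m (a b : G) : G := tmul a b.

Lemma mulBDr (a b c d : G) : m a (b - c + d) = m a b - m a c + m a d.
Proof. by rewrite -(hop_retract b) -hop_retract [LHS]tmulDr. Qed.

Lemma mulBDl (a b c d : G) : m (b - c + d) a = m b a - m c a + m d a.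
Proof. by rewrite -(hop_retract b) -hop_retract [LHS]tmulDl. Qed.

Lemma mul00 : m 0 0 = 0.
Proof. exact: T_boolean. Qed.

Lemma mul_idem a : m a a = a.
Proof. exact: T_boolean. Qed.

Lemma mul_assoc a b c : m a (m b c) = m (m a b) c.
Proof. exact: tmulA. Qed.

Definition lpart (a : G) : G := m a 0.
Definition rpart (b : G) : G := m 0 b.

(** The biadditive part of [m]: its constant term [m 0 0] is zero by idempotence. *)
Definition bilin (a b : G) : G := m a b - m 0 b - m a 0.

Lemma lpart_zmod_morphism : zmod_morphism lpart.
Proof. by move=> a b; rewrite /lpart -[a - b]addr0 mulBDl mul00 addr0. Qed.

Lemma rpart_zmod_morphism : zmod_morphism rpart.
Proof. by move=> a b; rewrite /rpart -[a - b]addr0 mulBDr mul00 addr0. Qed.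

HB.instance Definition _ :=
  GRing.isZmodMorphism.Build G G lpart lpart_zmod_morphism.
HB.instance Definition _ :=
  GRing.isZmodMorphism.Build G G rpart rpart_zmod_morphism.

Lemma lpartD a b : lpart (a + b) = lpart a + lpart b.
Proof. exact: raddfD. Qed.

Lemma rpartD a b : rpart (a + b) = rpart a + rpart b.
Proof. exact: raddfD. Qed.

Lemma mulE a b : m a b = bilin a b + lpart a + rpart b.
Proof. by rewrite /bilin subrK subrK. Qed.

Lemma bilinDl : left_distributive bilin +%R.
Proof.
move=> a b c; rewrite /bilin -/(lpart (a + b)) lpartD.
by rewrite -{1}[a]subr0 mulBDl -[_ + m b c - _]addrA opprD addrACA.
Qed.

Lemma bilinDr : right_distributive bilin +%R.
Proof.
move=> a b c; rewrite /bilin -/(rpart (b + c)) rpartD.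
rewrite -{1}[b]subr0 mulBDr addrAC.
by rewrite -[_ + m a c - _]addrA opprD addrACA; congr (_ + _); rewrite addrAC.
Qed.

(** [bilin x x] is also an additive function of [x], by idempotence, so its
    polarization [bilin a b + bilin b a] vanishes. *)
Lemma bilin_anti a b : bilin b a = - bilin a b.
Proof.
have bilin_sq x : bilin x x = x - (lpart x + rpart x).
  by apply/eqP; rewrite eq_sym subr_eq -{1}[x]mul_idem mulE addrA.
have : bilin (a + b) (a + b) = bilin a a + bilin b b.
  by rewrite !bilin_sq lpartD rpartD [lpart a + _ + _]addrACA opprD addrACA.
rewrite bilinDl !bilinDr -addrA => /addrI.
rewrite addrA -[RHS]add0r => /addIr ab_ba.
by apply/eqP; rewrite -addr_eq0 addrC ab_ba.
Qed.

Lemma lpartK a : lpart (lpart a) = lpart a.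
Proof. by rewrite /lpart -mul_assoc mul00. Qed.

Lemma rpartK a : rpart (rpart a) = rpart a.
Proof. by rewrite /rpart mul_assoc mul00. Qed.

Lemma rpart_lpart a : rpart (lpart a) = lpart (rpart a).
Proof. exact: mul_assoc. Qed.

(** This identity and the next two are associativity of [m] with the third,
    the first and the second argument equal to 0. *)
Lemma bilin_lpartr a b : bilin a (lpart b) = lpart (bilin a b).
Proof.
have := mul_assoc a b 0; rewrite -/(lpart b) -/(lpart (m a b)) !mulE !lpartD.
by rewrite lpartK rpart_lpart => /addIr/addIr.
Qed.

Lemma bilin_rpartl a b : bilin (rpart a) b = rpart (bilin a b).
Proof.
have := mul_assoc 0 a b; rewrite -/(rpart a) -/(rpart (m a b)) !mulE !rpartD.
by rewrite rpartK rpart_lpart => /addIr/addIr.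
Qed.

Lemma bilin_mid a b : bilin (lpart a) b = bilin a (rpart b).
Proof.
have := mul_assoc a 0 b; rewrite -/(rpart b) -/(lpart a) !mulE lpartK rpartK.
by move=> /addIr/addIr.
Qed.

(** Antisymmetry carries the action of [lpart] from the right factor to the
    left one; together with [bilin_mid] this identifies it with that of
    [rpart]. *)
Lemma bilin_lpartl a b : bilin (lpart a) b = lpart (bilin a b).
Proof. by rewrite bilin_anti bilin_lpartr bilin_anti (raddfN lpart) opprK. Qed.

Lemma bilin_rpartr a b : bilin a (rpart b) = lpart (bilin a b).
Proof. by rewrite -bilin_mid bilin_lpartl. Qed.

Lemma rpart_bilin a b : rpart (bilin a b) = lpart (bilin a b).
Proof.
rewrite -bilin_rpartl bilin_anti bilin_rpartr.
by rewrite bilin_anti (raddfN lpart) opprK.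
Qed.

(** In the expansion of [m a (m b c) = m (m a b) c] all terms other than the
    two iterated products are, by the identities above, the same six terms on
    both sides. *)
Lemma bilinA : associative bilin.
Proof.
move=> a b c; have := mul_assoc a b c; rewrite !mulE.
rewrite (bilinDr a (_ + _) (rpart c)) (bilinDr a (bilin b c)).
rewrite (bilinDl (_ + _) (rpart b)) (bilinDl (bilin a b)).
rewrite lpartD lpartD rpartD rpartD.
rewrite bilin_lpartr bilin_rpartr bilin_lpartl bilin_rpartl !rpart_bilin.
rewrite rpart_lpart lpartK rpartK.
move=> assoc; apply: (addIr (lpart (bilin a b) + lpart (bilin a c) + lpart a +
  (lpart (bilin b c) + lpart (rpart b) + rpart c))).
rewrite [LHS](AC (1*(3*3)) ((1*2*3*4)*(5*6*7))).
rewrite [LHS]assoc.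
by rewrite [LHS](AC (3*3*1) (1*((4*2*5)*(3*6*7)))).
Qed.

Definition boolean_truss_rng : rng := Rng bilinA bilinDl bilinDr.

Lemma inhabited_truss_decomposition : has_boolean_decomposition T.
Proof.
pose lam : {additive boolean_truss_rng -> boolean_truss_rng} := lpart.
pose rho : {additive boolean_truss_rng -> boolean_truss_rng} := rpart.
apply: (@peirce_iso boolean_truss_rng lam rho lpartK rpartK rpart_lpart
  bilin_lpartl bilin_lpartr _ bilin_rpartr rpart_bilin _ T id).
- by move=> a b; rewrite [LHS]bilin_rpartl rpart_bilin.
- by move=> a; rewrite -[RHS]mul_idem [RHS]mulE.
- exact: (Bijective (g := id)).
- exact: hop_retract.
- exact: mulE.
Qed.

End BooleanTruss.

(** * The empty truss, and the converse *)

(** The empty heap itself is the left and the right zero factor, which makes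
    the product empty whatever the two rings are. *)
Lemma empty_truss_decomposition (T : truss) :
  (T -> False) -> has_boolean_decomposition T.
Proof.
move=> T0; pose mul0 (x y : 'I_1) : 'I_1 := 0.
have mulA : associative mul0 by [].
have mulDl : left_distributive mul0 +%R by move=> x y z; rewrite addr0.
have mulDr : right_distributive mul0 +%R by move=> x y z; rewrite addr0.
pose Z := Rng mulA mulDl mulDr.
have Z_boolean : boolean_rng Z by move=> x; rewrite [RHS]ord1.
exists Z, Z, T, T; split=> //; split=> //.
exists (fun x => (((0 : Z, 0 : Z), x), x)); split.
  by split=> x; case: (T0 x).
by exists snd => [x | [y x]] //; case: (T0 x).
Qed.

Lemma boolean_circle_truss (A : rng) :
  boolean_rng A -> boolean_truss (circle_truss A).
Proof.
move=> A_boolean x; rewrite /= /circ A_boolean.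
(* Expanding (x + x)^2 = x + x yields 4x = 2x. *)
suff xx0 : x + x = 0 :> A by rewrite xx0 add0r.
apply: (addIr (x + x : A)); rewrite add0r.
by rewrite -[RHS]A_boolean rmulDl !rmulDr A_boolean.
Qed.

Lemma boolean_prod_truss (S T : truss) :
  boolean_truss S -> boolean_truss T -> boolean_truss (prod_truss S T).
Proof. by move=> hS hT [x y]; rewrite /= /prod_mul /= hS hT. Qed.

Lemma boolean_truss_iso (S T : truss) :
  truss_iso S T -> boolean_truss T -> boolean_truss S.
Proof.
move=> [f [[_ f_mul] /bij_inj f_inj]] hT x.
by apply: f_inj; rewrite f_mul hT.
Qed.

Theorem theorem3p8 (T : truss) :
  boolean_truss T <->
  exists (A B : rng) (L R : abHeap),
    boolean_rng A /\ boolean_rng B /\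
    truss_iso T
      (prod_truss
         (prod_truss
            (prod_truss (circle_truss A) (rng_truss B))
            (left_zero_truss L))
         (right_zero_truss R)).
Proof.
split=> [T_boolean | [A [B [L [R [hA [hB T_iso]]]]]]]; last first.
  apply: boolean_truss_iso T_iso _.
  apply: boolean_prod_truss => //; apply: boolean_prod_truss => //.
  by apply: boolean_prod_truss => //; exact: boolean_circle_truss.
have [[o] | T0] := pselect (inhabited T); last first.
  by apply: empty_truss_decomposition => x; apply: T0.
exact: inhabited_truss_decomposition o T_boolean.
Qed.
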